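(* Let $g(t,x)$ and $h_1(t,x),\dots,h_M(t,x)$ be vector fields on $\mathbb{R}^N$, $f(t,x,u)=g+\sum_{i=1}^M h_iu_i$, and let the default control be $v=0$, so that $f_1=g$ and $f_2=g+\sum_{i=1}^M h_iu_i$ with $u\in\mathbb{R}^M$. Then the mode insertion Hessian $\frac{d^2J}{d\lambda_+^2}$ (defined in the context) satisfies $$\frac{d^2J}{d\lambda_+^2}=\sum_{i=1}^M\sum_{j=1}^M u_iu_j\,h_i^T\Omega h_j+\rho^T\Big(\sum_{i=2}^M\sum_{j=1}^{i-1}[h_i,h_j]u_iu_j+2\sum_{i=2}^M\sum_{j=1}^{i-1}(D_xh_i)h_j\,u_iu_j+\sum_{i=1}^M(D_xh_i)h_i\,u_i^2+\sum_{i=1}^M[g,h_i]u_i\Big)-D_xl_1\sum_{i=1}^M h_iu_i .$$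
   Context: Setting. $J(x)=\int_{t_0}^{t_f}l_1(x(t))\,dt+m(x(t_f))$; $x$ is the trajectory of the default dynamics $f_1=f(t,x,v)$ on $[t_0,t_f]$; $f_2=f(t,x,u)$ is the inserted dynamics. Regularity assumptions: the components of $f_1,f_2$ are real, bounded, $C^2$ in $x$ and $C^0$ in $u,t$; $l_1$ is real, bounded and $C^2$; $m$ is real and twice differentiable; $u,v$ are real, bounded and continuous in $t$. First- and second-order adjoints $\rho(t)\in\mathbb{R}^N$, $\Omega(t)\in\mathbb{R}^{N\times N}$ along $x$: $\dot\rho=-D_xl_1^T-D_xf_1^T\rho$, $\rho(t_f)=D_xm(x(t_f))^T$; $\dot\Omega=-D_xf_1^T\Omega-\Omega D_xf_1-D_x^2l_1-\sum_{i=1}^N\rho_iD_x^2f_1^i$, $\Omega(t_f)=D_x^2m(x(t_f))^T$, where $f_1^i$ is the $i$-th component of $f_1$. Mode insertion Hessian (evaluated at the insertion time $t$, along $x$): $$\frac{d^2J}{d\lambda_+^2}=(f_2-f_1)^T\Omega(f_2-f_1)+\rho^T\big(D_xf_2\cdot f_2+D_xf_1\cdot f_1-2D_xf_1\cdot f_2\big)-D_xl_1\cdot(f_2-f_1).$$ Lie bracket (in $x$, at fixed $t$): $[a,b]=\frac{\partial b}{\partial x}a-\frac{\partial a}{\partial x}b$. *)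

(* Defs.v *)
(* MathComp / MathComp-Analysis.  Points of R^N and vector fields are column
   vectors; first derivatives of scalar functions are row vectors. *)
From HB Require Import structures.
From mathcomp Require Import all_boot all_order all_algebra.
From mathcomp Require Import all_classical all_reals all_analysis.
Set Implicit Arguments.
Unset Strict Implicit.
Unset Printing Implicit Defensive.
Import Order.TTheory GRing.Theory Num.Theory.
Import numFieldNormedType.Exports.
Local Open Scope classical_set_scope.
Local Open Scope ring_scope.

(* D_x F for a scalar F: the row of partial derivatives. *)
Definition grad (R : realType) (n : nat) (F : 'cV[R]_n -> R) (x : 'cV[R]_n)
  : 'rV[R]_n := \row_j 'D_(delta_mx j 0) F x.

(* D_x F for a vector-valued F: row i is D_x of the i-th component. *)
Definition jac (R : realType) (n m : nat) (F : 'cV[R]_n -> 'cV[R]_m)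
    (x : 'cV[R]_n) : 'M[R]_(m, n) :=
  \matrix_(i, j) grad (fun y => F y i 0) x 0 j.

(* D_x^2 F for a scalar F. *)
Definition hess (R : realType) (n : nat) (F : 'cV[R]_n -> R) (x : 'cV[R]_n)
  : 'M[R]_n := jac (fun y => (grad F y)^T) x.

Definition lie_bracket (R : realType) (n : nat) (a b : 'cV[R]_n -> 'cV[R]_n)
    (x : 'cV[R]_n) : 'cV[R]_n := jac b x *m a x - jac a x *m b x.

(* Differentiability is in the Frechet sense. *)
Definition twice_differentiable (R : realType) (n : nat) (F : 'cV[R]_n -> R)
  : Prop :=
  (forall x, differentiable F x) /\ (forall x, differentiable (grad F) x).

Definition C2 (R : realType) (n : nat) (F : 'cV[R]_n -> R) : Prop :=
  twice_differentiable F /\ continuous (hess F).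

(* A time-dependent field induced by a dynamics f(t,x,u) and a control u(t). *)
Definition controlled (R : realType) (N M : nat)
    (f : R -> 'cV[R]_N -> 'cV[R]_M -> 'cV[R]_N) (u : R -> 'cV[R]_M)
  : R -> 'cV[R]_N -> 'cV[R]_N := fun t x => f t x (u t).

Definition control_affine (R : realType) (N M : nat)
    (g : R -> 'cV[R]_N -> 'cV[R]_N) (h : 'I_M -> R -> 'cV[R]_N -> 'cV[R]_N)
  : R -> 'cV[R]_N -> 'cV[R]_M -> 'cV[R]_N :=
  fun t x w => g t x + \sum_(i < M) w i 0 *: h i t x.

Definition admissible_control (R : realType) (M : nat) (t0 tf : R)
    (u : R -> 'cV[R]_M) : Prop :=
  {within `[t0, tf], continuous u} /\ [bounded u t | t in `[t0, tf]].

(* Smoothness is required of f for every control value w in R^M.  Boundedness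
   is not: an affine f is unbounded in w, so it is required, separately, of the
   fields obtained by inserting the admissible controls (see bounded_field). *)
Definition regular_dynamics (R : realType) (N M : nat) (t0 tf : R)
    (f : R -> 'cV[R]_N -> 'cV[R]_M -> 'cV[R]_N) : Prop :=
  (forall t w i, t \in `[t0, tf] -> C2 (fun x => f t x w i 0)) /\
  (forall x, {within `[t0, tf] `*` [set: 'cV[R]_M],
                continuous (fun p : R * 'cV[R]_M => f p.1 x p.2)}).

Definition bounded_field (R : realType) (N : nat) (t0 tf : R)
    (F : R -> 'cV[R]_N -> 'cV[R]_N) : Prop :=
  [bounded F p.1 p.2 | p in `[t0, tf] `*` [set: 'cV[R]_N]].

(* y' = F on ]a, b[, with y continuous up to the end points. *)
Definition solves_ode (R : realType) (V : normedModType R) (a b : R)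
    (y F : R -> V) : Prop :=
  {within `[a, b], continuous y} /\
  (forall t : R, t \in `]a, b[ -> is_derive t (1 : R) y (F t)).

Definition trajectory (R : realType) (N : nat) (t0 tf : R)
    (f1 : R -> 'cV[R]_N -> 'cV[R]_N) (x : R -> 'cV[R]_N) : Prop :=
  solves_ode t0 tf x (fun t => f1 t (x t)).

Definition first_adjoint (R : realType) (N : nat) (t0 tf : R)
    (l1 m : 'cV[R]_N -> R) (f1 : R -> 'cV[R]_N -> 'cV[R]_N)
    (x rho : R -> 'cV[R]_N) : Prop :=
  solves_ode t0 tf rho
    (fun t => - (grad l1 (x t))^T - (jac (f1 t) (x t))^T *m rho t) /\
  rho tf = (grad m (x tf))^T.

Definition second_adjoint (R : realType) (N : nat) (t0 tf : R)
    (l1 m : 'cV[R]_N -> R) (f1 : R -> 'cV[R]_N -> 'cV[R]_N)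
    (x rho : R -> 'cV[R]_N) (Omega : R -> 'M[R]_N) : Prop :=
  solves_ode t0 tf Omega
    (fun t => - ((jac (f1 t) (x t))^T *m Omega t)
              - Omega t *m jac (f1 t) (x t)
              - hess l1 (x t)
              - \sum_(i < N) rho t i 0 *: hess (fun y => f1 t y i 0) (x t)) /\
  Omega tf = (hess m (x tf))^T.

(* The entry at (0, 0) reads a 1 x 1 matrix as a scalar. *)
Definition mode_insertion_hessian (R : realType) (N : nat)
    (l1 : 'cV[R]_N -> R) (f1 f2 : R -> 'cV[R]_N -> 'cV[R]_N)
    (x rho : R -> 'cV[R]_N) (Omega : R -> 'M[R]_N) (t : R) : R :=
  let d := f2 t (x t) - f1 t (x t) in
  (d^T *m Omega t *m d
   + (rho t)^T *m (jac (f2 t) (x t) *m f2 t (x t)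
                   + jac (f1 t) (x t) *m f1 t (x t)
                   - 2%:R *: (jac (f1 t) (x t) *m f2 t (x t)))
   - grad l1 (x t) *m d) 0 0.

(* Main.v *)
Require Import Defs.
From HB Require Import structures.
From mathcomp Require Import all_boot all_order all_algebra.
From mathcomp Require Import all_classical all_reals all_analysis.
From mathcomp Require Import ring.
Import Order.TTheory GRing.Theory Num.Theory.
Import numFieldNormedType.Exports.
Local Open Scope classical_set_scope.
Local Open Scope ring_scope.

(** With [H] the inserted field, [f2 = g + H], the Jacobian terms of the Hessian
    reduce to [D H . H + [g, H]].  Expanding [D H . H] over pairs and grouping
    [(i, j)] with [(j, i)] gives the brackets, since
    [(D h_i) h_j + (D h_j) h_i = [h_i, h_j] + 2 (D h_i) h_j]. *)

Section JacobianCalculus.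
Variables (R : realType) (n m : nat).
Implicit Types (F G : 'cV[R]_n -> 'cV[R]_m) (x : 'cV[R]_n).

(** [jac] is assembled from directional derivatives of the entries, so differentiability is asked
    entrywise, the form in which [regular_dynamics] supplies it. *)
Lemma jacD F G x :
  (forall i, differentiable (fun y => F y i 0) x) ->
  (forall i, differentiable (fun y => G y i 0) x) ->
  jac (fun y => F y + G y) x = jac F x + jac G x.
Proof.
move=> dF dG; apply/matrixP => i j; rewrite !mxE.
rewrite -deriveD; [|exact: diff_derivable..].
by congr ('D_ _ _ _); apply/funext => y; rewrite mxE.
Qed.

Lemma jacZ (c : R) F x :
  (forall i, differentiable (fun y => F y i 0) x) ->
  jac (fun y => c *: F y) x = c *: jac F x.
Proof.
move=> dF; apply/matrixP => i j; rewrite !mxE.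
(* The product in [R] is reread as a scaling, the shape that [deriveZ] expects. *)
rewrite [RHS](_ : _ = c *: 'D_(delta_mx j 0) (fun y => F y i 0) x) //.
rewrite -deriveZ; last exact: diff_derivable.
by congr ('D_ _ _ _); apply/funext => y; rewrite mxE.
Qed.

Lemma differentiable_comp_lincomb (I : Type) (r : seq I) (c : I -> R)
    (H : I -> 'cV[R]_n -> 'cV[R]_m) x i :
  (forall k, differentiable (fun y => H k y i 0) x) ->
  differentiable (fun y => (\sum_(k <- r) c k *: H k y) i 0) x.
Proof.
move=> dH; elim: r => [|k r IHr].
  rewrite (_ : (fun _ => _) = cst 0); first exact: differentiable_cst.
  by apply/funext => y; rewrite big_nil mxE.
rewrite (_ : (fun _ => _) = c k *: (fun y => H k y i 0)
    + (fun y => (\sum_(k <- r) c k *: H k y) i 0)).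
  by apply: differentiableD => //; apply: differentiableZ.
by apply/funext => y; rewrite big_cons !mxE.
Qed.

(** Serves to differentiate the inserted field at a frozen time, where the control values are
    constants [c k] with respect to the state. *)
Lemma jac_lincomb (I : Type) (r : seq I) (c : I -> R)
    (H : I -> 'cV[R]_n -> 'cV[R]_m) x :
  (forall k i, differentiable (fun y => H k y i 0) x) ->
  jac (fun y => \sum_(k <- r) c k *: H k y) x = \sum_(k <- r) c k *: jac (H k) x.
Proof.
move=> dH; elim: r => [|k r IHr].
  rewrite big_nil; apply/matrixP => i j; rewrite !mxE.
  rewrite (_ : (fun _ => _) = cst 0) ?derive_cst //.
  by apply/funext => y; rewrite big_nil mxE.
rewrite big_cons -IHr -jacZ // -jacD.
- by congr (jac _ x); apply/funext => y; rewrite big_cons.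
- move=> i; rewrite (_ : (fun _ => _) = c k *: (fun y => H k y i 0)).
    exact: differentiableZ.
  by apply/funext => y; rewrite mxE.
- by move=> i; apply: differentiable_comp_lincomb.
Qed.

End JacobianCalculus.

Section ControlAffine.
Set Implicit Arguments.
Unset Strict Implicit.
Variables (R : realType) (N M : nat).
Variables (g : R -> 'cV[R]_N -> 'cV[R]_N) (h : 'I_M -> R -> 'cV[R]_N -> 'cV[R]_N).

Lemma control_affine0 t x : control_affine g h t x 0 = g t x.
Proof. by rewrite /control_affine big1 ?addr0 // => i _; rewrite mxE scale0r. Qed.

Lemma control_affine_delta t x k :
  control_affine g h t x (delta_mx k 0) = g t x + h k t x.
Proof.
rewrite /control_affine (bigD1 k) //= mxE !eqxx scale1r big1 ?addr0 // => i ik.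
by rewrite mxE (negPf ik) scale0r.
Qed.

(* Regularity is assumed of [f] only; the fields are recovered from the
   control values [0] and the unit vectors. *)
Lemma regular_control_affine_differentiable t0 tf t x i :
  regular_dynamics t0 tf (control_affine g h) -> t \in `[t0, tf] ->
  differentiable (fun y => g t y i 0) x /\
  (forall k, differentiable (fun y => h k t y i 0) x).
Proof.
move=> [fC2 _] tI.
have df w : differentiable (fun y => control_affine g h t y w i 0) x.
  by have [[+ _] _] := fC2 t w i tI; apply.
have dg : differentiable (fun y => g t y i 0) x.
  rewrite (_ : (fun _ => _) = fun y => control_affine g h t y 0 i 0) //.
  by apply/funext => y; rewrite control_affine0.
split=> // k.
rewrite (_ : (fun _ => _) =
    (fun y => control_affine g h t y (delta_mx k 0) i 0) - (fun y => g t y i 0)).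
  exact: differentiableB.
apply/funext => y.
rewrite [RHS](_ : _ = control_affine g h t y (delta_mx k 0) i 0 - g t y i 0) //.
by rewrite control_affine_delta mxE addrAC subrr add0r.
Qed.

End ControlAffine.

(** Each row is cut at the diagonal; swapping the two indices carries the terms above the diagonal
    to positions below it, where they pair up. *)
Lemma sum_ord_pairs (V : zmodType) (M : nat) (F : 'I_M -> 'I_M -> V) :
  \sum_(i < M) \sum_(j < M) F i j =
  \sum_(i < M) \sum_(j < M | (j < i)%N) (F i j + F j i) + \sum_(i < M) F i i.
Proof.
have -> : \sum_(i < M) \sum_(j < M | (j < i)%N) (F i j + F j i) =
    \sum_(i < M) \sum_(j < M | (j < i)%N) F i j
    + \sum_(i < M) \sum_(j < M | (i < j)%N) F i j.
  under eq_bigr do rewrite big_split /=.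
  rewrite big_split /=; congr (_ + _).
  (* Exchanging the summations turns [F j i] over [j < i] into [F i j] over [i < j]. *)
  by rewrite (exchange_big_dep predT).
rewrite -!big_split /=; apply: eq_bigr => i _.
rewrite (bigID (fun j : 'I_M => (j < i)%N)) /= -addrA; congr (_ + _).
rewrite (bigD1 i) ?ltnn //= addrC; congr (_ + _).
by apply: eq_bigl => j; rewrite -leqNgt ltn_neqAle andbC eq_sym.
Qed.

(** Here [Jg] and [JH] stand for the Jacobians of [g] and [H]. The two copies of [Jg *m g] cancel
    against the doubled term, and one [Jg *m H] minus two leaves the negative half of the bracket
    [[g, H]]. *)
Lemma insertion_drift_cancel (R : realType) (N : nat) (Jg JH : 'M[R]_N) (g H : 'cV[R]_N) :
  (Jg + JH) *m (g + H) + Jg *m g - 2%:R *: (Jg *m (g + H)) =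
  JH *m H + (JH *m g - Jg *m H).
Proof.
rewrite !mulmxDl !mulmxDr scaler_nat.
(* Naming the products keeps [mxE] from expanding them into sums, so that [ring] sees their entries
   as atoms. *)
set a := Jg *m g; set b := Jg *m H; set c := JH *m g; set e := JH *m H.
apply/matrixP => i j; rewrite !mxE; ring.
Qed.

(** Ordinals start at [0], and the row [i = 0] of a sum over [j < i] is empty; this matches outer
    sums starting at the second index. *)
Theorem mainTheorem2 (R : realType) (N M : nat) (t0 tf : R)
    (g : R -> 'cV[R]_N -> 'cV[R]_N) (h : 'I_M -> R -> 'cV[R]_N -> 'cV[R]_N)
    (l1 m : 'cV[R]_N -> R) (u v : R -> 'cV[R]_M)
    (x rho : R -> 'cV[R]_N) (Omega : R -> 'M[R]_N) (t : R) :
  let f := control_affine g h in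
  let f1 := controlled f v in
  let f2 := controlled f u in
  t0 < tf ->
  v = (fun=> 0) ->
  admissible_control t0 tf u -> admissible_control t0 tf v ->
  regular_dynamics t0 tf f ->
  bounded_field t0 tf f1 -> bounded_field t0 tf f2 ->
  C2 l1 -> [bounded l1 y | y in [set: 'cV[R]_N]] ->
  twice_differentiable m ->
  trajectory t0 tf f1 x ->
  first_adjoint t0 tf l1 m f1 x rho ->
  second_adjoint t0 tf l1 m f1 x rho Omega ->
  t \in `[t0, tf] ->
  mode_insertion_hessian l1 f1 f2 x rho Omega t =
    \sum_(i < M) \sum_(j < M)
      u t i 0 * u t j 0 * ((h i t (x t))^T *m Omega t *m h j t (x t)) 0 0
    + ((rho t)^T *m
       (\sum_(i < M) \sum_(j < M | (j < i)%N)
          (u t i 0 * u t j 0) *: lie_bracket (h i t) (h j t) (x t)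
        + 2%:R *: \sum_(i < M) \sum_(j < M | (j < i)%N)
          (u t i 0 * u t j 0) *: (jac (h i t) (x t) *m h j t (x t))
        + \sum_(i < M) (u t i 0) ^+ 2 *: (jac (h i t) (x t) *m h i t (x t))
        + \sum_(i < M) u t i 0 *: lie_bracket (g t) (h i t) (x t))) 0 0
    - (grad l1 (x t) *m \sum_(i < M) u t i 0 *: h i t (x t)) 0 0.
Proof.
move=> f f1 f2 _ v0 _ _ reg _ _ _ _ _ _ _ _ tI.
have dg i y : differentiable (fun z => g t z i 0) y.
  by have [] := regular_control_affine_differentiable y i reg tI.
have dh k i y : differentiable (fun z => h k t z i 0) y.
  by have [_] := regular_control_affine_differentiable y i reg tI; apply.
(* Equality as functions of the state, not merely at [x t], is what allows rewriting under [jac]. *)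
have f1E : f1 t = g t.
  by apply/funext => y; rewrite /f1 v0; exact: control_affine0.
pose y := x t; pose c k := u t k 0.
pose H := \sum_(k < M) c k *: h k t y.
pose JH := \sum_(k < M) c k *: jac (h k t) y.
have f2y : f2 t y = g t y + H by [].
have jf2 : jac (f2 t) y = jac (g t) y + JH.
  rewrite /JH -jac_lincomb // -jacD // => i.
  exact: differentiable_comp_lincomb.
have JHH : JH *m H =
    \sum_(i < M) \sum_(j < M) (c i * c j) *: (jac (h i t) y *m h j t y).
  rewrite mulmx_suml; apply: eq_bigr => i _; rewrite mulmx_sumr.
  by apply: eq_bigr => j _; rewrite -scalemxAl -scalemxAr scalerA.
have JHH_brackets : JH *m H =
    \sum_(i < M) \sum_(j < M | (j < i)%N)
      (c i * c j) *: lie_bracket (h i t) (h j t) y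
    + 2%:R *: \sum_(i < M) \sum_(j < M | (j < i)%N)
      (c i * c j) *: (jac (h i t) y *m h j t y)
    + \sum_(i < M) c i ^+ 2 *: (jac (h i t) y *m h i t y).
  rewrite JHH sum_ord_pairs; congr (_ + _).
  rewrite scaler_sumr -big_split /=; apply: eq_bigr => i _.
  rewrite scaler_sumr -big_split /=; apply: eq_bigr => j _.
  (* Both terms of a pair carry the same coefficient. The negative term of the bracket then absorbs
     one of the two copies of [jac (h i t) y *m h j t y]. *)
  rewrite [c j * c i]mulrC scaler_nat scalerMnr -!scalerDr.
  by rewrite /lie_bracket addrC mulr2n addrA subrK.
have drift : JH *m g t y - jac (g t) y *m H =
    \sum_(i < M) c i *: lie_bracket (g t) (h i t) y.
  rewrite mulmx_suml mulmx_sumr -sumrB; apply: eq_bigr => i _.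
  by rewrite -scalemxAl -scalemxAr -scalerBr.
have quad : (H^T *m Omega t *m H) 0 0 = \sum_(i < M) \sum_(j < M)
    c i * c j * ((h i t y)^T *m Omega t *m h j t y) 0 0.
  rewrite (raddf_sum trmx) !mulmx_suml summxE; apply: eq_bigr => i _.
  rewrite mulmx_sumr summxE; apply: eq_bigr => j _.
  rewrite /= [(_ *: _)^T]linearZ /= -scalemxAr -!scalemxAl.
  by rewrite scalerA mxE [c j * c i]mulrC.
(* The increment [f2 - f1] collapses to [H] in the quadratic term and in the [grad l1] term. *)
rewrite /mode_insertion_hessian f1E -/y f2y jf2 /= [g t y + H - _]addrC addKr.
rewrite insertion_drift_cancel drift JHH_brackets -quad.
by rewrite 2!mxE [X in _ + X]mxE.
Qed.
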